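(* Let $\{X_n\}_{n\ge0}$ be compact metric spaces, $\{L_n\colon C(X_n)\to C(X_{n+1})\}_{n\ge0}$ bounded linear operators, and $\{\Lambda_n\subset C_n^+\subset C(X_n)\}_{n\ge0}$ closed convex cones satisfying conditions (C1), (C2), (C3) of the context. Then the following hold. [A] For every $n\ge 0$ and every sequence of measures $\{\sigma_\ell\in M(X_\ell)\}_{\ell\ge n}$, the limits $$\lambda_n=\lim_{k\to\infty}\frac{\langle \mathbf{L}_n^k\mathbf{1},\sigma_{n+k}\rangle}{\langle \mathbf{L}_{n+1}^{k-1}\mathbf{1},\sigma_{n+k}\rangle},\qquad m_n=\lim_{k\to\infty}\frac{(\mathbf{L}_n^k)^*\sigma_{n+k}}{\langle \mathbf{1},(\mathbf{L}_n^k)^*\sigma_{n+k}\rangle}$$ exist (the second in the weak* topology on $M(X_n)$) and are independent of the choice of $\{\sigma_\ell\}$. [B] Each real number $\lambda_n$ is positive, each $m_n$ is a probability measure, and $L_n^*m_{n+1}=\lambda_n m_n$. [C] $(m_n)_{n\ge 0}$ is the unique sequence of Borel probability measures $m_n\in M(X_n)$ with the property that $L_n^*m_{n+1}$ is a scalar multiple of $m_n$ for every $n\geq 0$. [D] There are constants $C_1>0$ and $\gamma\in(0,1)$ such that for any $n\ge 0$, any $k\ge\tau$, any $\sigma\in M(X_{n+k})$, and any $f\in\Lambda_n$, $$\Big|\log\lambda_n-\log\frac{\langle \mathbf{L}_n^k\mathbf{1},\sigma\rangle}{\langle \mathbf{L}_{n+1}^{k-1}\mathbf{1},\sigma\rangle}\Big|\le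 C_1\gamma^k\quad\text{and}\quad \Big|\langle f,m_n\rangle-\frac{\langle f,(\mathbf{L}_n^k)^*\sigma\rangle}{\langle\mathbf{1},(\mathbf{L}_n^k)^*\sigma\rangle}\Big|\le C_1\|f\|\gamma^k.$$
   Context: A subset $\Lambda\subset\Omega\setminus\{0\}$ of a Banach space $\Omega$ is a convex cone if $t\Lambda=\Lambda$ for all $t>0$ and $f+g\in\Lambda$ for all $f,g\in\Lambda$; it is a closed convex cone if moreover $\Lambda\cup\{0\}$ is norm-closed. Write $f\preceq g$ iff $g-f\in\Lambda\cup\{0\}$, $A(f,g)=\sup\{t>0:tf\preceq g\}$, $B(f,g)=\inf\{t>0:g\preceq tf\}$. The Hilbert projective metric of $\Lambda$ is $\Theta(f,g)=\log\frac{B(f,g)}{A(f,g)}\in[0,\infty]$. $C(X_n)$ has the sup norm $\|\cdot\|=\|\cdot\|_\infty$; $C_n^+=\{f\in C(X_n):f\ge0,f\not\equiv0\}$; $\mathbf{1}$ is the constant function $1$; $\mathbf{L}_n^k=L_{n+k-1}\circ\cdots\circ L_n\colon C(X_n)\to C(X_{n+k})$ ($\mathbf{L}_n^0$ the identity). $M(X_n)$ is the set of positive (nonzero) finite Borel measures on $X_n$; $\langle f,m\rangle=\int f\,dm$; $L_n^*$ is the dual operator, defined by $\langle f,L_n^*m\rangle=\langle L_nf,m\rangle$ for $f\in C(X_n)$, $m\in M(X_{n+1})$, and similarly $(\mathbf{L}_n^k)^*$. $\Theta_n$ is the Hilbert projective metric of $\Lambda_n$. The conditions are (for all $n\ge0$):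 (C1) Each $\Lambda_n\subset C(X_n)$ is a closed convex cone with $\mathbf{1}\in\Lambda_n\subset C_n^+$. (C2) Each $L_n$ is a bounded linear operator with $L_n\Lambda_n\subset\Lambda_{n+1}$, and there exists $\kappa\ge1$ such that for all $n$, $\kappa^{-1}\le L_n\mathbf{1}(x)\le\kappa$ for all $x\in X_{n+1}$ and $\|L_nf\|_\infty\le\kappa\|f\|_\infty$ for all $f\in\Lambda_n$. Moreover there exist $\Delta\in(0,\infty)$ and $\tau\in\mathbb{N}$ such that for every $n$, $\operatorname{diam}_{\Theta_{n+\tau}}\mathbf{L}_n^\tau\Lambda_n\le\Delta$ and $\sup\mathbf{L}_n^\tau\mathbf{1}\le e^\Delta\inf\mathbf{L}_n^\tau\mathbf{1}$. (C3) With $\Lambda_n^p=\{f\in C_n^+:\mathbf{L}_n^pf\in\Lambda_{n+p}\}$ and $\Lambda_n^\infty=\bigcup_{p=0}^\infty\Lambda_n^p$, the set $\Lambda_n^\infty-\Lambda_n^\infty$ is uniformly dense in $C(X_n)$ for every $n$.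
   Formalization: It is assumed that each dual operator L_n^* maps M(X_{n+1}) into M(X_n), i.e. L_n f ≥ 0 for all f ≥ 0; (C1)–(C3) alone do not imply this, and without it the limit m_n can be a signed measure. *)

(* Defs.v *)
From HB Require Import structures.
From mathcomp Require Import all_boot all_order all_algebra.
From mathcomp Require Import all_classical all_reals all_analysis.

Set Implicit Arguments.
Unset Strict Implicit.
Unset Printing Implicit Defensive.

Import Order.TTheory GRing.Theory Num.Theory.
Import numFieldNormedType.Exports.

Local Open Scope classical_set_scope.
Local Open Scope ring_scope.

HB.mixin Record isCompactSpace T & Topological T := {
  compactT : compact [set: T]
}.

(* The base point is there because the measurable types of the library are
   pointed; it only says that the space is nonempty. *)
#[short(type="compactMetricType")]
HB.structure Definition CompactMetric (R : numDomainType) :=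
  {T of Metric R T & Pointed T & isCompactSpace T}.

Definition C (R : realType) (X : compactMetricType R) := continuousType X R.

Section continuous_functions.
Context {R : realType} {X : compactMetricType R}.
Implicit Types f g : C X.

Definition cts_pred : {pred X -> R} := mem [set f : X -> R | continuous f].

HB.instance Definition _ := Choice.on (C X).

Definition C_Sub (h : X -> R) (hP : h \in cts_pred) : C X :=
  mkcts (set_mem hP).

Local Lemma C_rect (K : C X -> Type) :
  (forall (h : X -> R) (hP : h \in cts_pred), K (C_Sub hP)) -> forall u : C X, K u.
Proof.
move=> Ksub u.
have uP : (u : X -> R) \in cts_pred by apply/mem_set; exact: cts_fun.
suff -> : u = C_Sub uP by exact: Ksub.
exact/continuousEP.
Qed.

Local Lemma C_SubK (h : X -> R) (hP : h \in cts_pred) : C_Sub hP = h :> (X -> R).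
Proof. by []. Qed.

HB.instance Definition _ :=
  isSub.Build (X -> R) (fun h => h \in cts_pred) (C X) C_rect C_SubK.

Lemma cts_submod_closed : submod_closed cts_pred.
Proof.
split=> [|a f g fc gc]; first by apply/mem_set; exact: cst_continuous.
apply/mem_set => x; apply: continuousD; last exact: (set_mem gc).
by apply: continuousM; [exact: cst_continuous|exact: (set_mem fc)].
Qed.

HB.instance Definition _ :=
  GRing.isSubmodClosed.Build _ _ cts_pred cts_submod_closed.
HB.instance Definition _ := [SubChoice_isSubLmodule of C X by <:].

Definition supnorm f : R := sup (range (fun x => `|f x|)).

Lemma supnorm_has_sup f : has_sup (range (fun x => `|f x|)).
Proof.
split; first by exists (`|f point|), point.
have cf : continuous (f : X -> R) by exact: cts_fun.
have : compact ((f : X -> R) @` setT).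
  apply: continuous_compact; last exact: compactT.
  exact: continuous_subspaceT.
move=> /compact_bounded [M [_ fM]].
exists (M + 1) => _ [x _ <-].
by apply: (fM (M + 1)); [rewrite ltrDl|exists x].
Qed.

Lemma le_supnorm f x : `|f x| <= supnorm f.
Proof. by apply: ub_le_sup; [case: (supnorm_has_sup f)|exists x]. Qed.

Lemma supnorm_le f (M : R) : (forall x, `|f x| <= M) -> supnorm f <= M.
Proof.
move=> fM; apply: ge_sup; first by case: (supnorm_has_sup f).
by move=> _ [x _ <-].
Qed.

Local Lemma ler_supnormD f g : supnorm (f + g) <= supnorm f + supnorm g.
Proof.
apply: supnorm_le => x; apply: (le_trans (ler_normD _ _)).
by apply: lerD; exact: le_supnorm.
Qed.

Local Lemma supnormZ (a : R) f : supnorm (a *: f) = `|a| * supnorm f.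
Proof.
have le_Z (b : R) (h : C X) : supnorm (b *: h) <= `|b| * supnorm h.
  apply: supnorm_le => x; rewrite [X in `|X|]/(b * h x) normrM.
  by apply: ler_wpM2l => //; exact: le_supnorm.
apply/eqP; rewrite eq_le le_Z /=.
have [->|a0] := eqVneq a 0.
  rewrite normr0 mul0r; exact: le_trans (normr_ge0 _) (le_supnorm _ point).
rewrite -ler_pdivlMl ?normr_gt0 // -normfV.
by rewrite -[X in supnorm X <= _](scalerK a0); exact: le_Z.
Qed.

Local Lemma supnorm0_eq0 f : supnorm f = 0 -> f = 0.
Proof.
move=> f0; apply/continuousEP => x; apply/eqP.
by rewrite -normr_le0 -f0; exact: le_supnorm.
Qed.

HB.instance Definition _ :=
  @Lmodule_isNormed.Build R (C X) supnorm ler_supnormD supnormZ supnorm0_eq0.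

Lemma C_normE f : `|f| = sup (range (fun x => `|f x|)).
Proof. by []. Qed.

Definition oneC : C X := mkcts (@cst_continuous X R 1).

Definition Cplus : set (C X) := [set f | (forall x, 0 <= f x) /\ f != 0].

End continuous_functions.

Arguments oneC {R} X.
Arguments Cplus {R} X.

Section cones.
Context {R : realType} {V : normedModType R}.
Implicit Types (K : set V) (f g : V).

Definition convex_cone K : Prop :=
  [/\ ~ K 0,
      forall t : R, 0 < t -> [set t *: f | f in K] = K &
      forall f g, K f -> K g -> K (f + g)].

Definition closed_convex_cone K : Prop :=
  convex_cone K /\ closed (K `|` [set 0]).

Definition cone_le K f g : Prop := (K `|` [set 0]) (g - f).

(* [maxe 0] makes the supremum of the empty set 0, as for subsets of
   [0, +oo]; in [\bar R] it would be -oo. *)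
Definition cone_A K f g : \bar R :=
  maxe 0%E (ereal_sup [set t%:E | t in [set t : R | 0 < t /\ cone_le K (t *: f) g]]).

Definition cone_B K f g : \bar R :=
  ereal_inf [set t%:E | t in [set t : R | 0 < t /\ cone_le K g (t *: f)]].

(* In the library 0^-1 = +oo, +oo^-1 = 0 and lne +oo = +oo, so that this is
   +oo when A = 0 or B = +oo. *)
Definition hilbert_metric K f g : \bar R :=
  lne (cone_B K f g / cone_A K f g)%E.

Definition hilbert_diam K (S : set V) : \bar R :=
  ereal_sup [set hilbert_metric K f g | f in S & g in S].

End cones.

Definition bounded_operator (R : realType) (V W : normedModType R)
    (T : V -> W) : Prop :=
  exists M : R, forall f, `|T f| <= M * `|f|.

Definition Borel (R : realType) (X : compactMetricType R) :=
  g_sigma_algebraType [set A : set X | open A].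

Record M (R : realType) (X : compactMetricType R) := MkM {
  M_measure :> {finite_measure set (Borel X) -> \bar R} ;
  M_neq0 : M_measure [set: Borel X] != 0%E
}.

Section duality.
Context {R : realType}.
Implicit Types X Y : compactMetricType R.

Definition pairing X (f : C X) (m : {measure set (Borel X) -> \bar R}) : R :=
  \int[m]_x f x.

(* T^* m, as the functional f |-> <f, T^* m> := <T f, m> on C(X). *)
Definition dual_op X Y (T : C X -> C Y)
    (m : {measure set (Borel Y) -> \bar R}) : C X -> R :=
  fun f => pairing (T f) m.

(* T^* acts as a map M(Y) -> M(X), i.e. every functional T^* m is represented
   by a positive nonzero finite Borel measure. This is not automatic: T may
   send a cone of nonnegative functions to nonnegative functions without
   preserving nonnegativity on all of C(X), and T^* m is then signed. *)
Definition dual_maps_measures X Y (T : C X -> C Y) : Prop :=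
  forall m : M Y, exists m' : M X, forall f : C X, pairing f m' = dual_op T m f.

Definition weak_star_cvg X (phi : nat -> C X -> R)
    (m : {measure set (Borel X) -> \bar R}) : Prop :=
  forall f : C X, phi k f @[k --> \oo] --> pairing f m.

End duality.

(* [addk n k] is n + k, with [addk n k.+1] convertible to [addk n.+1 k], so
   that L_n^(k+1) 1 and L_(n+1)^k 1 live in the same space C(X_(n+k+1)). *)
Fixpoint addk (n k : nat) : nat := if k is k'.+1 then addk n.+1 k' else n.

Lemma addkE n k : addk n k = (n + k)%N.
Proof. by elim: k n => [|k IHk] n /=; rewrite ?addn0// IHk addSnnS. Qed.

Section sequences.
Context {R : realType} {X : nat -> compactMetricType R}.
Variable L : forall n, {linear C (X n) -> C (X n.+1)}.
Variable Lambda : forall n, set (C (X n)).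
Arguments Lambda : clear implicits.

(* L_n^(k+1) = L_(n+1)^k \o L_n, which associates the composition
   L_(n+k-1) \o ... \o L_n from the inside. *)
Fixpoint Lk (n k : nat) : C (X n) -> C (X (addk n k)) :=
  match k return C (X n) -> C (X (addk n k)) with
  | 0 => fun f => f
  | k'.+1 => fun f => @Lk n.+1 k' (L n f)
  end.
Arguments Lk : clear implicits.

Definition cond_C1 : Prop := forall n,
  [/\ closed_convex_cone (Lambda n),
      Lambda n (oneC (X n)) &
      Lambda n `<=` Cplus (X n)].

Definition cond_C2 (kappa Delta : R) (tau : nat) : Prop :=
  [/\ 1 <= kappa,
      0 < Delta,
      forall n, bounded_operator (L n) /\ L n @` Lambda n `<=` Lambda n.+1,
      forall n,
        (forall x, kappa^-1 <= L n (oneC (X n)) x <= kappa) /\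
        (forall f, Lambda n f -> `|L n f| <= kappa * `|f|) &
      forall n,
        (hilbert_diam (Lambda (addk n tau)) (Lk n tau @` Lambda n)
           <= Delta%:E)%E /\
        sup (range (Lk n tau (oneC (X n)))) <=
          expR Delta * inf (range (Lk n tau (oneC (X n))))].

Definition Lambda_p (n p : nat) : set (C (X n)) :=
  [set f | Cplus (X n) f /\ Lambda (addk n p) (Lk n p f)].
Arguments Lambda_p : clear implicits.

Definition Lambda_oo (n : nat) : set (C (X n)) :=
  \bigcup_(p in [set: nat]) Lambda_p n p.
Arguments Lambda_oo : clear implicits.

Definition cond_C3 : Prop := forall n,
  dense [set f - g | f in Lambda_oo n & g in Lambda_oo n].

Definition dual_eigensequence
    (m : forall n, probability (Borel (X n)) R) : Prop :=
  forall n, exists c : R, forall f : C (X n),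
    dual_op (L n) (m n.+1) f = c * pairing f (m n).

End sequences.

Arguments Lk {R X} L n k f.
Arguments Lambda_p {R X} L Lambda n p.
Arguments Lambda_oo {R X} L Lambda n.

(* Main.v *)
Require Import Defs.
From HB Require Import structures.
From mathcomp Require Import all_boot all_order all_algebra.
From mathcomp Require Import all_classical all_reals all_analysis.
From mathcomp Require Import measurable_realfun ring lra.

Set Implicit Arguments.
Unset Strict Implicit.
Unset Printing Implicit Defensive.

Import Order.TTheory GRing.Theory Num.Theory.
Import numFieldNormedType.Exports.

Local Open Scope classical_set_scope.
Local Open Scope ring_scope.

(** The dual operator of each [L n] carries Dirac masses to positive measures,
so [L n] is a positive operator on all of C(X_n). Hence an inequality
a L_n^k g <= L_n^k f <= b L_n^k g that holds pointwise for one k persists for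
every larger k, and everything below is a matter of producing such
inequalities with b - a small.

They come from the cones. Suppose a g and b g enclose f in the order of
Lambda_n. After tau steps the images of f - a g and b g - f lie in a set of
Hilbert diameter at most Delta, so each of them is enclosed, in the order of
Lambda_(n+tau), by two multiples of the image of g whose ratio is at most a
constant E depending on Delta alone. The two upper multiples add up to at
least b - a, so the two lower ones add up to at least (b - a) / E; subtracting
the lower ones narrows the enclosure by the factor 1 - 1/E
([diam_contraction]). Iterating gives an exponential rate for every pair of
functions of Lambda_n ([within_rate]).

With g = L_n^p 1 this covers the functions of Lambda_n^p, and by density every
f in C(X_n) ([all_convergent]): there is a unique number [limfun f] such that
L_n^k f - [limfun f] L_n^k 1 is, uniformly, negligible compared with L_n^k 1.
The map [limfun] is linear, positive and normalized, hence is the integral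
against a probability measure m_n ([riesz_representation]). Integrating the
enclosures against any sigma gives the convergence of the normalized dual
iterates, with the rate, and shows that the limit does not depend on sigma
([approx_ratio]). The quotient defining lambda_n is the quotient belonging to
the function L_n 1 one step later, so lambda_n = m_(n+1)(L_n 1), and the
eigenvalue equation is the same observation for a general f ([limfun_L]).
Finally, for a sequence of probability measures m' whose dual images are
proportional, the quotient of the integrals of L_n^k f and L_n^k 1 is exactly
the integral of f, whence it equals [limfun f] ([eigensequence_limfun]), and
integrals of continuous functions determine a finite Borel measure
([pairing_inj]). *)

(** * Continuous functions on a compact metric space *)

Section continuous_functions.
Context {R : realType} {X : compactMetricType R}.
Implicit Types (f g : C X) (U : set X).

Lemma CDE f g x : (f + g) x = f x + g x. Proof. by []. Qed.
Lemma CNE f x : (- f) x = - f x. Proof. by []. Qed.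
Lemma CBE f g x : (f - g) x = f x - g x. Proof. by []. Qed.
Lemma CZE (a : R) f x : (a *: f) x = a * f x. Proof. by []. Qed.
Lemma C0E x : (0 : C X) x = 0. Proof. by []. Qed.
Lemma oneCE x : oneC X x = 1. Proof. by []. Qed.
Definition CE := (CDE, CNE, CZE, C0E, oneCE).

Lemma C_ext f g : (forall x, f x = g x) -> f = g.
Proof. by move=> fg; apply/continuousEP. Qed.

Lemma le_normC f x : `|f x| <= `|f|.
Proof. exact: le_supnorm. Qed.

Lemma C_le_norm f x : f x <= `|f|.
Proof. exact: le_trans (ler_norm _) (le_normC f x). Qed.

Definition truncC f (t : R) : C X :=
  mkcts (fun x => @continuous_min _ _ _ _ _
    (@cts_fun _ _ f x) (@cst_continuous X R t x)).

End continuous_functions.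

Section codist.
Context {R : realType} {X : compactMetricType R}.
Implicit Types (U : set X) (x y : X).

Let dset U x : set R := [set 1] `|` [set mdist x y | y in ~` U].

(** The distance from x to the complement of U, capped at 1. The cap keeps the
infimum meaningful for U the whole space, where there is no distance to take. *)
Definition codist U (x : X) : R := inf (dset U x).

Let dset_inf U x : has_inf (dset U x).
Proof.
split; first by exists 1; left.
by exists 0 => _ [->|[y _ <-]] //; exact: mdist_ge0.
Qed.

Lemma codist_ge0 U x : 0 <= codist U x.
Proof.
apply: lb_le_inf; first by case: (dset_inf U x).
by move=> _ [->|[y _ <-]] //; exact: mdist_ge0.
Qed.

Lemma codist_eq0 U x : ~ U x -> codist U x = 0.
Proof.
move=> nUx; apply/eqP; rewrite eq_le codist_ge0 andbT.
rewrite -(mdistxx x); apply: ge_inf; first by case: (dset_inf U x).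
by right; exists x.
Qed.

Lemma codist_gt0 U x : open U -> U x -> 0 < codist U x.
Proof.
move=> oU Ux; have /nbhs_ballP[e /= e0 eU] : nbhs x U by exact: open_nbhs_nbhs.
apply: (@lt_le_trans _ _ (Num.min 1 e)); first by rewrite lt_min ltr01.
apply: lb_le_inf; first by case: (dset_inf U x).
move=> _ [->|[y nUy <-]]; first by rewrite ge_min lexx.
rewrite ge_min; apply/orP; right; rewrite leNgt; apply/negP => xye.
by apply: nUy; apply: eU; rewrite ballEmdist.
Qed.

Lemma codist_lip U x y : codist U x <= codist U y + mdist x y.
Proof.
rewrite -lerBlDr; apply: lb_le_inf; first by case: (dset_inf U y).
move=> _ [->|[z nUz <-]]; rewrite lerBlDr.
  apply: (@le_trans _ _ 1); last by rewrite lerDl mdist_ge0.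
  by apply: ge_inf; [case: (dset_inf U x)|left].
apply: (@le_trans _ _ (mdist x z)).
  by apply: ge_inf; [case: (dset_inf U x)|right; exists z].
by rewrite addrC metric_triangle.
Qed.

Lemma codist_continuous U : continuous (codist U).
Proof.
move=> x; apply/cvgrPdist_lt => e e0; apply/nbhs_ballP; exists e => //= y.
rewrite ballEmdist/= => xye; rewrite ltr_norml.
have := codist_lip U x y; have := codist_lip U y x; rewrite (metric_sym y x).
by move=> h1 h2; apply/andP; split; lra.
Qed.

(** The functions min(j d(x, ~U), 1) increase with j to the indicator of an open
set U; they stand for it wherever a continuous function is needed. *)
Lemma bump_continuous U (j : nat) :
  continuous (fun x => Num.min (j%:R * codist U x) 1 : R).
Proof.
move=> x; apply: (@continuous_min _ _ (fun x => j%:R * codist U x) (fun=> 1)).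
  by apply: continuousM; [exact: cst_continuous|exact: codist_continuous].
exact: cst_continuous.
Qed.

Definition bump U j : C X := mkcts (bump_continuous (U := U) (j := j)).

Lemma bumpE U j x : bump U j x = Num.min (j%:R * codist U x) 1.
Proof. by []. Qed.

Lemma bump_ge0 U j x : 0 <= bump U j x.
Proof. by rewrite bumpE le_min ler01 mulr_ge0 ?codist_ge0. Qed.

Lemma bump_le1 U j x : bump U j x <= 1.
Proof. by rewrite bumpE ge_min lexx orbT. Qed.

Lemma bump_out U j x : ~ U x -> bump U j x = 0.
Proof. by move=> /codist_eq0 dx; rewrite bumpE dx mulr0 min_l. Qed.

Lemma bump_nondecreasing U x :
  {homo (fun j => bump U j x) : i j / (i <= j)%N >-> i <= j}.
Proof.
move=> i j ij; rewrite !bumpE le_min !ge_min lexx !orbT andbT.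
by rewrite ler_wpM2r ?codist_ge0 ?ler_nat.
Qed.

Lemma bump_eventually1 U x : open U -> U x -> \forall j \near \oo, bump U j x = 1.
Proof.
move=> oU Ux; near=> j; rewrite bumpE min_r//.
rewrite -ler_pdivrMr ?codist_gt0//.
by near: j; exact: nbhs_infty_ger.
Unshelve. all: by end_near. Qed.

End codist.

(** * Integrals of continuous functions *)

Section pairing.
Context {R : realType} {X : compactMetricType R}.
Implicit Types (f g : C X) (U : set X).
Implicit Types (m : {finite_measure set (Borel X) -> \bar R}).

Lemma open_Borel U : open U -> measurable (U : set (Borel X)).
Proof. by move=> oU; exact: sub_sigma_algebra. Qed.

Lemma C_measurable f : measurable_fun setT (f : Borel X -> R).
Proof.
apply: (measurability _ (RGenOInfty.measurableE R)) => _ [_ [a ->] <-].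
rewrite setTI; apply: open_Borel.
apply: open_comp; last exact: interval_open.
by move=> x _; exact: cts_fun.
Qed.

Lemma C_integrable m f : m.-integrable setT (EFin \o (f : Borel X -> R)).
Proof.
apply: measurable_bounded_integrable => //.
- by rewrite -ge0_fin_numE// fin_num_measure.
- exact: C_measurable.
- exists `|f|; split; first exact: num_real.
  by move=> M fM x _; exact: le_trans (le_normC f x) (ltW fM).
Qed.

Lemma pairingD m f g : pairing (f + g) m = pairing f m + pairing g m.
Proof. by rewrite /pairing -RintegralD//; exact: C_integrable. Qed.

Lemma pairingZ m (a : R) f : pairing (a *: f) m = a * pairing f m.
Proof. by rewrite /pairing -RintegralZl//; exact: C_integrable. Qed.

Lemma le_pairing m f g : (forall x, f x <= g x) -> pairing f m <= pairing g m.
Proof. by move=> fg; apply: le_Rintegral => //; exact: C_integrable. Qed.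

Lemma pairing_one m : pairing (oneC X) m = fine (m setT).
Proof. by rewrite /pairing Rintegral_cst// mul1r. Qed.

Lemma pairing_EFin m f : (pairing f m)%:E = (\int[m]_x (f x)%:E)%E.
Proof. by rewrite /pairing fineK// integrable_fin_num//; exact: C_integrable. Qed.

Lemma pairing_bump_cvg m U : open U ->
  (pairing (bump U j) m)%:E @[j --> \oo] --> m (U : set (Borel X)).
Proof.
move=> oU.
have mU : measurable (U : set (Borel X)) by exact: open_Borel.
under eq_fun do rewrite pairing_EFin.
have -> : m U = (\int[m]_x (\1_U x)%:E)%E.
  by rewrite integral_indic// setIT.
have bU x : (bump U j x)%:E @[j --> \oo] --> (\1_U x)%:E.
  apply: cvg_EFin; first exact: nearW.
  have [Ux|nUx] := pselect (U x).
    rewrite indicE mem_set//; apply: cvg_near_cst.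
    exact: bump_eventually1.
  rewrite indicE memNset//; apply: cvg_near_cst; apply: nearW => j.
  by rewrite /= [LHS]bump_out.
under eq_integral do rewrite -(cvg_lim _ (bU _))//.
apply: cvg_monotone_convergence => //.
- move=> j; apply/measurable_EFinP; exact: C_measurable.
- by move=> j x _; rewrite lee_fin bump_ge0.
- by move=> x _ i j ij; rewrite lee_fin bump_nondecreasing.
Qed.

(** By monotone convergence along the bumps the integrals determine the measure
of every open set, and open sets form a pi-system generating the Borel sets. *)
Lemma pairing_inj (m m' : {finite_measure set (Borel X) -> \bar R}) :
  (forall f, pairing f m = pairing f m') ->
  forall A : set (Borel X), measurable A -> m A = m' A.
Proof.
move=> mm' A mA.
apply: (@measure_unique _ R (Borel X) [set U : set X | open U] (fun=> setT)
  _ _ _ _ m m') => //.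
- by move=> U V oU oV; exact: openI.
- by move=> _; exact: openT.
- by rewrite bigcup_const//.
- move=> U oU.
  have mU := @pairing_bump_cvg m U oU; have := @pairing_bump_cvg m' U oU.
  under eq_fun do rewrite -mm'.
  by move=> m'U; exact: (cvg_unique _ mU m'U).
- by move=> _; rewrite -ge0_fin_numE// fin_num_measure.
Qed.

End pairing.

(** * The Riesz representation of a positive normalized functional *)

Section riesz.
Context {R : realType} {X : compactMetricType R} (phi : C X -> R).
Hypothesis phi_scalar : scalar phi.
Hypothesis phi_ge0 : forall f : C X, (forall x, 0 <= f x) -> 0 <= phi f.
Hypothesis phi_one : phi (oneC X) = 1.
Implicit Types (f g : C X) (U V : set X) (A : set X).

Let phiD f g : phi (f + g) = phi f + phi g.
Proof. by have := phi_scalar 1 f g; rewrite scale1r mul1r. Qed.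

Let phi0 : phi 0 = 0.
Proof. by apply: (@addrI _ (phi 0)); rewrite -phiD !addr0. Qed.

Let phiZ (a : R) f : phi (a *: f) = a * phi f.
Proof. by have := phi_scalar a f 0; rewrite phi0 !addr0. Qed.

Let phiB f g : phi (f - g) = phi f - phi g.
Proof. by rewrite phiD -scaleN1r phiZ mulN1r. Qed.

Let phi_sum (F : nat -> C X) n :
  phi (\sum_(i < n) F i) = \sum_(i < n) phi (F i).
Proof. exact: (big_morph phi phiD phi0). Qed.

Let le_phi f g : (forall x, f x <= g x) -> phi f <= phi g.
Proof.
by move=> fg; rewrite -subr_ge0 -phiB phi_ge0// => x; rewrite CBE subr_ge0.
Qed.

Definition subordinate U : set (C X) :=
  [set f | (forall x, 0 <= f x <= 1) /\ (forall x, ~ U x -> f x = 0)].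

Definition content U : R := sup [set phi f | f in subordinate U].

Let content_has_sup U : has_sup [set phi f | f in subordinate U].
Proof.
split; first by exists (phi 0), 0 => //; split=> // x; rewrite C0E lexx ler01.
exists 1 => _ [f [f01 _] <-]; rewrite -phi_one; apply: le_phi => x.
by case/andP: (f01 x).
Qed.

Let le_content U f : subordinate U f -> phi f <= content U.
Proof.
by move=> Uf; apply: ub_le_sup; [case: (content_has_sup U)|exists f].
Qed.

Let content_le U (c : R) :
  (forall f, subordinate U f -> phi f <= c) -> content U <= c.
Proof.
move=> Uc; apply: ge_sup; first by case: (content_has_sup U).
by move=> _ [f Uf <-]; exact: Uc.
Qed.

Let content_ge0 U : 0 <= content U.
Proof.
rewrite -phi0; apply: le_content; split=> // x; by rewrite C0E lexx ler01.
Qed.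

Let content_le1 U : content U <= 1.
Proof.
apply: content_le => f [f01 _]; rewrite -phi_one; apply: le_phi => x.
by case/andP: (f01 x).
Qed.

Let content_setT : content setT = 1.
Proof.
apply/eqP; rewrite eq_le content_le1 -phi_one; apply: le_content.
by split=> [x|x []] //; rewrite oneCE ler01 lexx.
Qed.

Let content_set0 : content set0 = 0.
Proof.
apply/eqP; rewrite eq_le content_ge0 andbT; apply: content_le => f [_ f0].
by rewrite -phi0; apply: le_phi => x; rewrite f0.
Qed.

Let content_subset U V : U `<=` V -> content U <= content V.
Proof.
move=> UV; apply: content_le => f [f01 fU]; apply: le_content; split=> // x Vx.
by apply: fU => /UV.
Qed.

Let bump_subordinate U j : subordinate U (bump U j).
Proof. by split=> x; [rewrite bump_ge0 bump_le1|exact: bump_out]. Qed.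

(** A Dini argument: the sums of bumps increase in m to a function that is at
least 1 on the union, so f minus these sums has nonpositive limit at every point,
and compactness makes one m serve all points. *)
Let subordinate_bigcup (F : nat -> set X) f (e : R) : (forall i, open (F i)) ->
  subordinate (\bigcup_i F i) f -> 0 < e ->
  exists m, forall x, f x <= (\sum_(i < m) bump (F i) m) x + e.
Proof.
move=> oF [f01 fF] e0.
pose h m := \sum_(i < m) bump (F i) m.
have hE m x : h m x = \sum_(i < m) bump (F i) m x.
  exact: (big_morph (fun g : C X => g x) (fun f g => CDE f g x) (C0E x)).
have h_ge0 m x : 0 <= h m x by rewrite hE sumr_ge0// => i _; exact: bump_ge0.
have h_le i x m : (i < m)%N -> bump (F i) m x <= h m x.
  move=> im; rewrite hE (bigD1 (Ordinal im))//= lerDl sumr_ge0// => k _.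
  exact: bump_ge0.
have /compact_near_coveringP/(_ _ \oo (fun m x => f x <= h m x + e)) :=
  @compactT R X.
case=> //; last by move=> m _ mP; exists m => x; apply: (mP m) => /=.
move=> x _.
have [[i _ Fix]|nFx] := pselect ((\bigcup_i F i) x).
- have [j _ jP] := bump_eventually1 (oF i) Fix.
  have : \forall y \near x, 1 - e < bump (F i) j y.
    have /cvgrPdist_lt/(_ _ e0) := @cts_fun _ _ (bump (F i) j) x.
    apply: filterS => y; rewrite jP/= ?ltr_norml; last exact: leqnn.
    by move=> /andP[_ ?]; lra.
  move=> near_x; near=> y m.
  have /= im : (maxn i.+1 j <= m)%N by near: m; exact: nbhs_infty_ge.
  move: im; rewrite geq_max => /andP[im jm].
  have by1 : 1 - e < bump (F i) j y by near: y.
  have := h_le i y m im; have := bump_nondecreasing (F i) y jm.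
  by have /andP[_] := f01 y; lra.
- have : \forall y \near x, f y < e.
    have /cvgrPdist_lt/(_ _ e0) := @cts_fun _ _ f x.
    apply: filterS => y; rewrite fF// sub0r normrN ltr_norml.
    by case/andP.
  move=> near_x; near=> y m.
  have fy : f y < e by near: y.
  by have := h_ge0 m y; lra.
Unshelve. all: by end_near. Qed.

Let content_sigma_subadditive (F : nat -> set X) : (forall i, open (F i)) ->
  ((content (\bigcup_i F i))%:E <= \sum_(i <oo) (content (F i))%:E)%E.
Proof.
move=> oF.
suff le_phi_f f : subordinate (\bigcup_i F i) f ->
    ((phi f)%:E <= \sum_(i <oo) (content (F i))%:E)%E.
  move: le_phi_f; move: (\sum_(_ <oo) _)%E => -[r| |] H.
  - by rewrite lee_fin; apply: content_le => f /H; rewrite lee_fin.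
  - by rewrite leey.
  - have /H : subordinate (\bigcup_i F i) 0.
      by split=> // x; rewrite C0E lexx ler01.
    by [].
move=> Ff; apply/lee_addgt0Pr => e e0.
have [m fm] := subordinate_bigcup oF Ff e0.
apply: (@le_trans _ _ ((\sum_(i < m) content (F i))%:E + e%:E)%E).
  rewrite -EFinD lee_fin.
  apply: (@le_trans _ _ (phi (\sum_(i < m) bump (F i) m + e *: oneC X))).
    by apply: le_phi => x; rewrite !CE mulr1.
  rewrite phiD phiZ phi_one mulr1 (phi_sum (fun i => bump (F i) m)) lerD2r.
  apply: ler_sum => i _.
  exact/le_content/bump_subordinate.
rewrite leeD2r// -sumEFin.
rewrite -(big_mkord xpredT (fun i => (content (F i))%:E)).
by apply: nneseries_lim_ge => i _ _; rewrite lee_fin.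
Qed.

Definition outer A : R := inf [set content U | U in [set U | open U /\ A `<=` U]].

Let outer_has_inf A :
  has_inf [set content U | U in [set U | open U /\ A `<=` U]].
Proof.
split; first by exists (content setT), setT => //; split=> //; exact: openT.
by exists 0 => _ [U _ <-].
Qed.

Let outer_le A U : open U -> A `<=` U -> outer A <= content U.
Proof.
by move=> oU AU; apply: ge_inf; [case: (outer_has_inf A)|exists U].
Qed.

Let le_outer A (c : R) :
  (forall U, open U -> A `<=` U -> c <= content U) -> c <= outer A.
Proof.
move=> cA; apply: lb_le_inf; first by case: (outer_has_inf A).
by move=> _ [U [oU AU] <-]; exact: cA.
Qed.

Let outer_open U : open U -> outer U = content U.
Proof.
move=> oU; apply/eqP; rewrite eq_le outer_le//=.
by apply: le_outer => V _; exact: content_subset.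
Qed.

Definition riesz_outer A : \bar R := (outer A)%:E.

Let riesz_outer0 : riesz_outer set0 = 0%E.
Proof. by rewrite /riesz_outer outer_open ?content_set0//; exact: open0. Qed.

Let riesz_outer_ge0 A : (0 <= riesz_outer A)%E.
Proof. by rewrite lee_fin; exact: le_outer. Qed.

Let le_riesz_outer : {homo riesz_outer : A B / A `<=` B >-> (A <= B)%E}.
Proof.
move=> A B AB; rewrite lee_fin; apply: le_outer => U oU BU.
by apply: outer_le => //; exact: subset_trans BU.
Qed.

Let riesz_outer_sigma_subadditive : sigma_subadditive riesz_outer.
Proof.
move=> F; apply/lee_addgt0Pr => e e0.
apply: (le_trans _ (epsilon_trick _ _ _)) => //; last exact: ltW.
have /choice[U FU] i : exists U, [/\ open U, F i `<=` U &
    content U <= outer (F i) + e / (2 ^ i.+1)%:R].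
  have ei : 0 < e / (2 ^ i.+1)%:R by rewrite divr_gt0// ltr0n expn_gt0.
  have [_ [U [oU FU] <-] cU] := inf_adherent ei (outer_has_inf (F i)).
  by exists U; split=> //; exact: ltW.
apply: (@le_trans _ _ (content (\bigcup_i U i))%:E).
  rewrite lee_fin; apply: outer_le.
    by apply: bigcup_open => i _; case: (FU i).
  by apply: subset_bigcup => i _; case: (FU i).
apply: (le_trans (content_sigma_subadditive _)).
  by move=> i; case: (FU i).
apply: lee_nneseries => i _; first by rewrite lee_fin.
by rewrite -EFinD lee_fin; case: (FU i).
Qed.

(** Take f subordinate to V `&` U and nearly optimal. The part of V where f is
small is an open neighbourhood W of V `\` U, and a function subordinate to W can
be added to f at the price of a factor 1 + e, because f < e on W. *)
Let content_split U V : open U -> open V ->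
  content (V `&` U) + outer (V `&` ~` U) <= content V.
Proof.
move=> oU oV; apply/ler_addgt0Pr => d d0.
pose e := d / 2; have e0 : 0 < e by rewrite divr_gt0.
have [_ [f [f01 fU] <-] cf] := sup_adherent e0 (content_has_sup (V `&` U)).
rewrite -/(content _) in cf.
pose W := V `&` f @^-1` [set r | r < e].
have oW : open W.
  apply: openI => //; apply: open_comp; last exact: open_lt.
  by move=> x _; exact: cts_fun.
have VW : V `&` ~` U `<=` W.
  by move=> x [Vx nUx]; split=> //=; rewrite fU// => -[].
have e1 : 0 < 1 + e by lra.
have cW : content W <= content V + e - phi f.
  apply: content_le => g [g01 gW].
  have : phi ((1 + e)^-1 *: (f + g)) <= content V.
    apply: le_content; split=> x; last first.
      by move=> nVx; rewrite CZE CDE fU ?gW ?addr0 ?mulr0// => -[].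
    rewrite CZE CDE; have /andP[f0 f1] := f01 x; have /andP[g0 g1] := g01 x.
    apply/andP; split.
      by apply: mulr_ge0; [rewrite invr_ge0 ltW|exact: addr_ge0].
    rewrite ler_pdivrMl// mulr1.
    have [[_ /= fe]|/gW ->] := pselect (W x); first by lra.
    by lra.
  rewrite phiZ phiD ler_pdivrMl// => fgV.
  have : e * content V <= e by apply: ler_piMr; [exact: ltW|exact: content_le1].
  move: fgV; rewrite mulrDl mul1r; lra.
by have := outer_le oW VW; rewrite /e in cf cW *; lra.
Qed.

Let open_caratheodory (mu : {outer_measure set X -> \bar R}) :
  mu = riesz_outer :> (set X -> \bar R) ->
  forall U, open U -> mu.-caratheodory U.
Proof.
move=> muE U oU; apply: le_caratheodory_measurable => A.
rewrite !muE /riesz_outer -EFinD lee_fin; apply: le_outer => V oV AV.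
apply: le_trans (content_split oU oV); apply: lerD.
  by apply: outer_le; [exact: openI|exact: setSI].
apply: le_outer => W oW VW; apply: outer_le => //.
by apply: subset_trans VW; exact: setSI.
Qed.

(** Slice f horizontally into layers of thickness t. The functional of the layer
min(f, t) is at most t times the measure of the set where f > 0, while its integral
is at least t times the measure of the set where f > t, which is the set supporting
the remaining layers; the comparison therefore telescopes and only the outermost
set survives. *)
Let layer_cake (m : {finite_measure set (Borel X) -> \bar R}) :
  (forall U, open U -> m U = (content U)%:E) ->
  forall (t : R) n f, 0 < t -> (forall x, 0 <= f x <= n%:R * t) ->
  phi f <= pairing f m + t * content [set x | 0 < f x].
Proof.
move=> mE t n f t0.
have open_pos g : open [set x | 0 < g x].
  apply: (@open_comp _ _ g [set r | 0 < r]); last exact: open_gt.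
  by move=> x _; exact: cts_fun.
elim: n f => [f f0|n IHn f f0t].
  apply: (@le_trans _ _ 0).
    rewrite -phi0; apply: le_phi => x; rewrite C0E.
    by have := f0 x; rewrite mul0r => /andP[].
  apply: addr_ge0; last by rewrite mulr_ge0// ltW.
  by apply: Rintegral_ge0 => x _; case/andP: (f0 x).
pose f1 := truncC f t; pose f2 := f - f1.
have f1E x : f1 x = Num.min (f x) t by [].
have f2E x : f2 x = f x - Num.min (f x) t by [].
have fE : f = f1 + f2 by rewrite /f2 addrC subrK.
have f2t x : 0 <= f2 x <= n%:R * t.
  have := f0t x; rewrite f2E -natr1 mulrDl mul1r.
  have : 0 <= n%:R * t by rewrite mulr_ge0// ltW.
  by case: (leP (f x) t) => ? ? /andP[? ?]; apply/andP; split; lra.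
have f1_sub : phi f1 <= t * content [set x | 0 < f x].
  rewrite -ler_pdivrMl// -phiZ; apply: le_content; split=> x.
    rewrite CZE f1E; have /andP[fx0 _] := f0t x.
    apply/andP; split; last by rewrite ler_pdivrMl// mulr1 ge_min lexx orbT.
    by rewrite mulr_ge0 ?invr_ge0 ?le_min ?fx0 ?(ltW t0).
  move=> /= /negP; rewrite -leNgt CZE f1E => fx0.
  have -> : f x = 0 by apply/le_anti; rewrite fx0; case/andP: (f0t x).
  by rewrite min_l ?mulr0// (ltW t0).
have f1_sup : t * content [set x | 0 < f2 x] <= pairing f1 m.
  rewrite -ler_pdivlMl// -pairingZ -lee_fin -mE//.
  have bump_m := @pairing_bump_cvg _ _ m _ (open_pos f2).
  apply: (cvge_to_le bump_m); apply: nearW => j; rewrite lee_fin.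
  apply: le_pairing => x; have [f2x|nf2x] := pselect (0 < f2 x); last first.
    rewrite bump_out// CZE f1E mulr_ge0 ?invr_ge0 ?le_min ?(ltW t0) ?andbT//.
    by case/andP: (f0t x).
  apply: (le_trans (bump_le1 _ _ _)); rewrite CZE f1E ler_pdivlMl// mulr1.
  by move: f2x; rewrite f2E; case: (leP (f x) t) => ?; lra.
have phiE : phi f = phi f1 + phi f2 by rewrite {1}fE phiD.
have pairingE : pairing f m = pairing f1 m + pairing f2 m.
  by rewrite {1}fE pairingD.
by have := IHn f2 f2t; rewrite phiE pairingE; lra.
Qed.

(** Letting the layers get thin gives the inequality phi f <= integral of f for
nonnegative f. It extends to all f by adding constants, on which both sides agree,
and applying it to - f turns it into an equality. *)
Let phi_eq_pairing (m : {finite_measure set (Borel X) -> \bar R}) :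
  (forall U, open U -> m U = (content U)%:E) ->
  forall f, pairing f m = phi f.
Proof.
move=> mE.
have m1 : pairing (oneC X) m = 1.
  by rewrite pairing_one mE ?content_setT//; exact: openT.
have phi_le_pos f : (forall x, 0 <= f x) -> phi f <= pairing f m.
  move=> f0; apply/ler_addgt0Pr => t t0.
  have [n nf] : exists n, `|f| <= n%:R * t.
    exists (Num.bound (`|f| / t)); rewrite -ler_pdivrMr//.
    by apply/ltW/archi_boundP; rewrite divr_ge0// ltW.
  have f0t x : 0 <= f x <= n%:R * t.
    by rewrite f0/=; exact: le_trans (C_le_norm f x) nf.
  have := layer_cake mE t0 f0t; have := content_le1 [set x | 0 < f x].
  by nra.
have phi_le f : phi f <= pairing f m.
  have : phi (f + `|f| *: oneC X) <= pairing (f + `|f| *: oneC X) m.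
    apply: phi_le_pos => x; rewrite CDE CZE oneCE mulr1.
    by have := le_normC f x; rewrite ler_norml => /andP[? _]; lra.
  by rewrite phiD phiZ pairingD pairingZ m1 phi_one lerD2r.
move=> f; apply/eqP; rewrite eq_le phi_le andbT.
have := phi_le (-1 *: f); rewrite phiZ pairingZ; lra.
Qed.

Theorem riesz_representation :
  exists m : probability (Borel X) R, forall f, pairing f m = phi f.
Proof.
pose mu : {outer_measure set X -> \bar R} :=
  HB.pack riesz_outer (isOuterMeasure.Build R X riesz_outer riesz_outer0
    riesz_outer_ge0 le_riesz_outer riesz_outer_sigma_subadditive).
have muE U : open U -> mu U = (content U)%:E.
  by move=> oU; congr EFin; exact: outer_open.
have Borel_cara : (measurable : set (set (Borel X))) `<=` mu.-caratheodory.
  apply: smallest_sub; last by move=> U; exact: (@open_caratheodory mu).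
  have := @sigma_algebra_measurable _ (caratheodory_type mu).
  by apply.
pose m0 : set (Borel X) -> \bar R := mu.
have m0_0 : m0 set0 = 0%E by exact: outer_measure0.
have m0_ge0 A : (0 <= m0 A)%E by exact: outer_measure_ge0.
have m0_add : semi_sigma_additive m0.
  move=> F mF tF mUF.
  apply: (@caratheodory_measure_sigma_additive _ _ mu F) => //.
    by move=> i; exact: (Borel_cara _ (mF i)).
  exact: (Borel_cara _ mUF).
have m0_1 : m0 setT = 1%E.
  by rewrite /m0 (muE setT openT) content_setT.
pose m1 : {measure set (Borel X) -> \bar R} :=
  HB.pack m0 (isMeasure.Build _ _ _ m0 m0_0 m0_ge0 m0_add).
pose m : probability (Borel X) R :=
  HB.pack m0 (isMeasure.Build _ _ _ m0 m0_0 m0_ge0 m0_add)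
     (Measure_isProbability.Build _ _ _ m1 m0_1).
by exists m; exact: (@phi_eq_pairing m).
Qed.

End riesz.

(** * Contraction of order intervals in a cone *)

Section cone_contraction.
Context {R : realType}.

Lemma CplusP (X : compactMetricType R) (f : C X) :
  Cplus X f -> exists x, 0 < f x.
Proof.
move=> [f0 fn0]; apply: contrapT => /forallNP nf; move/eqP: fn0; apply.
by apply/funext => x; apply/le_anti; rewrite f0 andbT leNgt; apply/negP/nf.
Qed.

Lemma cone_le_pointwise (X : compactMetricType R) (K : set (C X)) (f g : C X) :
  K `<=` Cplus X -> cone_le K f g -> forall x, f x <= g x.
Proof.
move=> Kpos [/Kpos[gf _]|gf] x; first by rewrite -subr_ge0 -CBE.
by rewrite (subr0_eq gf).
Qed.

(** The constant is exp (Delta + 1) and not exp Delta so that suprema and infima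
can be replaced by nearby values, without discussing whether they are attained. *)
Definition distortion (Delta : R) : R := expR (Delta + 1).

Definition contraction (Delta : R) : R := 1 - (distortion Delta)^-1.

Lemma distortion_gt1 (Delta : R) : 0 < Delta -> 1 < distortion Delta.
Proof. by move=> D0; rewrite expR_gt1 addr_gt0. Qed.

Lemma contraction01 (Delta : R) : 0 < Delta -> 0 < contraction Delta < 1.
Proof.
move=> /distortion_gt1 E1; have E0 := lt_trans ltr01 E1.
by rewrite subr_gt0 invf_lt1// E1 ltrBlDr ltrDl invr_gt0.
Qed.

(** Pointwise positivity bounds A from above and B away from 0, so a finite value
of log (B / A) forces both to be positive and finite with B <= e^Delta A. *)
Lemma hilbert_diam_comparable (X : compactMetricType R) (K S : set (C X))
    (Delta : R) (f g : C X) :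
  K `<=` Cplus X -> S `<=` K -> (hilbert_diam K S <= Delta%:E)%E ->
  S f -> S g ->
  exists alpha beta, [/\ 0 < alpha, beta <= distortion Delta * alpha,
    cone_le K (alpha *: g) f & cone_le K f (beta *: g)].
Proof.
move=> Kpos SK diamS Sf Sg.
have [x gx0] := CplusP (Kpos _ (SK _ Sg)).
have [y fy0] := CplusP (Kpos _ (SK _ Sf)).
have g0 : 0 < `|g| by apply: lt_le_trans gx0 (C_le_norm g x).
have A_le : (cone_A K g f <= (f x / g x)%:E)%E.
  rewrite /cone_A ge_max lee_fin divr_ge0 ?(ltW gx0)//=; last first.
    by have [+ _] := Kpos _ (SK _ Sf); apply.
  apply: ge_ereal_sup => _ [t [_ tgf] <-]; rewrite lee_fin ler_pdivlMr//.
  by have := cone_le_pointwise Kpos tgf x; rewrite CZE.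
have B_ge : ((f y / `|g|)%:E <= cone_B K g f)%E.
  apply: le_ereal_inf_tmp => _ [t [t0 ftg] <-]; rewrite lee_fin ler_pdivrMr//.
  apply: le_trans (cone_le_pointwise Kpos ftg y) _; rewrite CZE.
  by rewrite ler_wpM2l ?(ltW t0)//; exact: C_le_norm.
have A_ge0 : (0 <= cone_A K g f)%E by rewrite /cone_A le_max lexx.
have B_gt0 : (0 < cone_B K g f)%E.
  by apply: lt_le_trans B_ge; rewrite lte_fin divr_gt0.
have theta_le : (hilbert_metric K g f <= Delta%:E)%E.
  by apply: le_trans diamS; apply: ereal_sup_ubound; exists g => //; exists f.
have A_gt0 : (0 < cone_A K g f)%E.
  rewrite lt_neqAle A_ge0 andbT; apply/eqP => A0.
  move: theta_le; rewrite /hilbert_metric -A0 inve0 gt0_muley//.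
have A_fin : cone_A K g f \is a fin_num.
  by rewrite ge0_fin_numE//; apply: le_lt_trans A_le (ltry _).
have B_fin : cone_B K g f \is a fin_num.
  rewrite fin_numE gt_eqF ?(lt_trans _ B_gt0)//=; apply/eqP => B_oo.
  move: theta_le; rewrite /hilbert_metric B_oo gt0_mulye//.
  rewrite -(fineK A_fin) inver gt_eqF ?fine_gt0 ?A_gt0 ?ltey_eq ?A_fin//.
  by rewrite lte_fin invr_gt0 fine_gt0// A_gt0 ltey_eq A_fin.
set a := fine (cone_A K g f); set b := fine (cone_B K g f).
have a0 : 0 < a by rewrite fine_gt0// A_gt0 ltey_eq A_fin.
have b0 : 0 < b by rewrite fine_gt0// B_gt0 ltey_eq B_fin.
have b_le : b <= expR Delta * a.
  move: theta_le; rewrite /hilbert_metric -(fineK A_fin) -(fineK B_fin) -/a -/b.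
  rewrite inver gt_eqF// -EFinM lne_EFin ?divr_gt0// lee_fin => ln_le.
  by rewrite -ler_pdivrMr// -[leLHS]lnK ?posrE ?divr_gt0// ler_expR.
(* Moving each of A and B by the factor exp (1/2) costs exp 1 in the quotient. *)
pose e : R := expR (1 / 2).
have e1 : 1 < e by rewrite expR_gt1.
have [_ [alpha [alpha0 alpha_le] <-]] : exists2 u,
    [set t%:E | t in [set t : R | 0 < t /\ cone_le K (t *: g) f]] u &
    ((a / e)%:E < u)%E.
  apply/ereal_sup_gt; apply: (@lt_le_trans _ _ a%:E).
    by rewrite lte_fin ltr_pdivrMr ?ltr_pMr// (lt_trans _ e1).
  move: A_gt0; rewrite /a fineK// /cone_A lt_max ltxx/= => sup_gt0.
  by rewrite ge_max lexx ltW.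
rewrite lte_fin => a_lt.
have [_ [beta [beta0 beta_le] <-]] : exists2 u,
    [set t%:E | t in [set t : R | 0 < t /\ cone_le K f (t *: g)]] u &
    (u < (b * e)%:E)%E.
  apply/ereal_inf_lt; apply: (@le_lt_trans _ _ b%:E); first by rewrite /b fineK.
  by rewrite lte_fin ltr_pMr.
rewrite lte_fin => b_lt.
exists alpha, beta; split=> //.
have eE : distortion Delta = expR Delta * (e * e).
  by rewrite /distortion expRD; congr (_ * _); rewrite -expRD -splitr.
rewrite eE ltW//; apply: (lt_trans b_lt).
have e0 : 0 < e by apply: lt_trans e1.
move: a_lt; rewrite ltr_pdivrMr// => a_lt.
have : b * e <= expR Delta * a * e by rewrite ler_wpM2r// ltW.
move/le_lt_trans; apply.
rewrite -!mulrA ltr_pM2l ?expR_gt0//.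
by rewrite (_ : e * (e * alpha) = alpha * e * e) ?ltr_pM2r//; ring.
Qed.

(** One step of the contraction. The multiples of T g that enclose the images of
f - a g and b g - f from below are subtracted from both ends of [a, b]; the
multiples that enclose them from above add up to at least b - a, as the images
add up to (b - a) T g. *)
Lemma diam_contraction (X Y : compactMetricType R) (K : set (C X))
    (K' : set (C Y)) (T : C X -> C Y) (Delta : R) (f g : C X) (a b : R) :
  0 < Delta -> (forall c u v, T (c *: u + v) = c *: T u + T v) ->
  K' `<=` Cplus Y -> T @` K `<=` K' ->
  (hilbert_diam K' (T @` K) <= Delta%:E)%E ->
  K g -> a <= b -> cone_le K (a *: g) f -> cone_le K f (b *: g) ->
  exists a' b', [/\ b' - a' <= contraction Delta * (b - a),
    cone_le K' (a' *: T g) (T f) & cone_le K' (T f) (b' *: T g)].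
Proof.
move=> D0 Tlin K'pos TK diamT Kg ab.
have E0 : 0 < distortion Delta by exact: lt_trans (distortion_gt1 D0).
have th_ge0 : 0 <= contraction Delta * (b - a).
  apply: mulr_ge0; last by rewrite subr_ge0.
  by case/andP: (contraction01 D0) => /ltW.
have T0 : T 0 = 0.
  apply: (@addrI _ (T 0)); rewrite addr0.
  by have := Tlin 1 0 0; rewrite !scale1r addr0.
have TZ c u : T (c *: u) = c *: T u.
  by have := Tlin c u 0; rewrite T0 !addr0.
have TBZ c u v : T (v - c *: u) = T v - c *: T u.
  by rewrite addrC -scaleNr Tlin scaleNr addrC.
have TZB c u v : T (c *: u - v) = c *: T u - T v.
  by rewrite Tlin -scaleN1r TZ scaleN1r.
(* If f is itself a multiple of g, the enclosure collapses to one point. *)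
move=> [Kp|p0]; last first.
  move: p0 => /= /subr0_eq ->.
  by move=> _; exists a, a; rewrite subrr TZ; split=> //; right; rewrite /= subrr.
move=> [Kq|q0]; last first.
  move: q0 => /= /subr0_eq <-.
  by exists b, b; rewrite subrr TZ; split=> //; right; rewrite /= subrr.
have TKg : (T @` K) (T g) by exists g.
have cmp h : K h -> exists al be, [/\ 0 < al, be <= distortion Delta * al,
    cone_le K' (al *: T g) (T h) & cone_le K' (T h) (be *: T g)].
  by move=> Kh; apply: (hilbert_diam_comparable K'pos TK diamT _ TKg); exists h.
have [al [be [al0 be_le pl pr]]] := cmp _ Kp.
have [al' [be' [al'0 be'_le ql qr]]] := cmp _ Kq.
exists (a + al), (b - al'); split.
- have [x gx] := CplusP (K'pos _ (TK _ TKg)).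
  have : (b - a) * T g x <= (be + be') * T g x.
    have := cone_le_pointwise K'pos pr x; have := cone_le_pointwise K'pos qr x.
    by rewrite TBZ TZB !CE; lra.
  rewrite ler_pM2r// => ba_le.
  have : (distortion Delta)^-1 * (b - a) <= al + al' by rewrite ler_pdivrMl//; lra.
  by rewrite /contraction; lra.
- move: pl; rewrite /cone_le TBZ.
  by congr ((_ `|` _) _); rewrite scalerDl opprD addrA.
- move: ql; rewrite /cone_le TZB.
  by congr ((_ `|` _) _); rewrite scalerBl addrAC.
Qed.

End cone_contraction.

(** * Iterates of the operators *)

Lemma bernoulli_ineq {R : realDomainType} (x : R) n :
  0 <= x <= 1 -> 1 - n%:R * x <= (1 - x) ^+ n.
Proof.
move=> /andP[x0 x1]; elim: n => [|n IHn]; first by rewrite mul0r subr0 expr0.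
have nx : 0 <= n%:R * x * x by rewrite !mulr_ge0.
have : (1 - x) * (1 - n%:R * x) <= (1 - x) * (1 - x) ^+ n.
  by rewrite ler_wpM2l// subr_ge0.
by rewrite exprS -natr1 mulrDl mul1r; lra.
Qed.

Section iterates.
Context {R : realType} {X : nat -> compactMetricType R}.
Variable L : forall n, {linear C (X n) -> C (X n.+1)}.
Variable Lambda : forall n, set (C (X n)).
Arguments Lambda : clear implicits.
Variables (kappa Delta : R) (tau : nat).
Hypothesis L_dual : forall n, dual_maps_measures (L n).
Hypothesis HC1 : cond_C1 Lambda.
Hypothesis HC2 : cond_C2 L Lambda kappa Delta tau.

(** L_n f (y) is the integral of f against the positive measure L_n^* delta_y. *)
Lemma L_ge0 n (f : C (X n)) :
  (forall x, 0 <= f x) -> forall y, 0 <= L n f y.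
Proof.
move=> f0 y.
have dirac0 : \d_(y : Borel (X n.+1)) setT != 0%E :> \bar R.
  by rewrite diracT onee_neq0.
pose dy := @MkM R (X n.+1) \d_(y : Borel (X n.+1)) dirac0.
have [m mE] := L_dual dy.
have <- : dual_op (L n) dy f = L n f y.
  rewrite /dual_op /pairing /Rintegral integral_dirac//.
    by rewrite diracT mul1e.
  by apply/measurable_EFinP; exact: C_measurable.
by rewrite -mE; apply: Rintegral_ge0.
Qed.

Let Lambda_Cplus n : Lambda n `<=` Cplus (X n).
Proof. by case: (HC1 n). Qed.

Let Lambda_one n : Lambda n (oneC (X n)).
Proof. by case: (HC1 n). Qed.

Let L_Lambda n f : Lambda n f -> Lambda n.+1 (L n f).
Proof. by have [_ _ /(_ n)[_ +] _ _] := HC2 => sub Lf; apply: sub; exists f. Qed.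

Let Delta_gt0 : 0 < Delta.
Proof. by case: HC2. Qed.

Let kappa_ge1 : 1 <= kappa.
Proof. by case: HC2. Qed.

Let kappa_gt0 : 0 < kappa.
Proof. exact: lt_le_trans kappa_ge1. Qed.

Let L_one n x : kappa^-1 <= L n (oneC (X n)) x <= kappa.
Proof. by have [_ _ _ /(_ n)[+ _] _] := HC2. Qed.

Let diam_tau n :
  (hilbert_diam (Lambda (addk n tau)) (Lk L n tau @` Lambda n) <= Delta%:E)%E.
Proof. by have [_ _ _ _ /(_ n)[]] := HC2. Qed.

Lemma LkP k : forall n c (u v : C (X n)),
  Lk L n k (c *: u + v) = c *: Lk L n k u + Lk L n k v.
Proof. by elim: k => [//|k IHk] n c u v /=; rewrite linearP IHk. Qed.

Lemma Lk_ge0 k : forall n (f : C (X n)),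
  (forall x, 0 <= f x) -> forall y, 0 <= Lk L n k f y.
Proof. by elim: k => [//|k IHk] n f f0 /=; apply: IHk; exact: L_ge0. Qed.

Lemma Lk0 k n : Lk L n k 0 = 0.
Proof.
apply: (@addrI _ (Lk L n k 0)); rewrite addr0.
by have := @LkP k n 1 0 0; rewrite !scale1r addr0.
Qed.

Lemma LkZ k n c (f : C (X n)) : Lk L n k (c *: f) = c *: Lk L n k f.
Proof. by have := LkP k c f 0; rewrite Lk0 !addr0. Qed.

Lemma le_Lk k n (f g : C (X n)) :
  (forall x, f x <= g x) -> forall y, Lk L n k f y <= Lk L n k g y.
Proof.
move=> fg y; have : 0 <= Lk L n k (-1 *: f + g) y.
  by apply: Lk_ge0 => x; rewrite !CE mulN1r addrC subr_ge0.
by rewrite LkP !CE mulN1r addrC subr_ge0.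
Qed.

Lemma Lk_Lambda k : forall n (f : C (X n)),
  Lambda n f -> Lambda (addk n k) (Lk L n k f).
Proof. by elim: k => [//|k IHk] n f Lf /=; apply/IHk/L_Lambda. Qed.

Lemma Lk_one_ge k : forall n x, kappa^-1 ^+ k <= Lk L n k (oneC (X n)) x.
Proof.
elim: k => [|k IHk] n x; first by rewrite /= oneCE expr0.
have := @le_Lk k n.+1 (kappa^-1 *: oneC _) (L n (oneC _)).
move=> /(_ _ x); rewrite LkZ CZE exprS => le_x; apply: le_trans (le_x _).
  by rewrite ler_wpM2l// invr_ge0 ltW.
by move=> y; rewrite CZE oneCE mulr1; case/andP: (L_one y).
Qed.

Lemma Lk_one_gt0 n k x : 0 < Lk L n k (oneC (X n)) x.
Proof. by apply: lt_le_trans (Lk_one_ge x); rewrite exprn_gt0// invr_gt0. Qed.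

(** Comparison of the k-th iterates. Stating it through f and g, and not through
functions on X_(n+k), keeps all changes of the splitting of n + k inside the
definition: starting later or iterating longer needs no transport of types. *)
Definition le_at n k (f g : C (X n)) : Prop :=
  forall x, Lk L n k f x <= Lk L n k g x.

Lemma le_at_shift p : forall n k (f g : C (X n)),
  le_at k (Lk L n p f) (Lk L n p g) -> le_at (p + k) f g.
Proof. by elim: p => [//|p IHp] n k f g /=; exact: IHp. Qed.

Lemma le_at_leq k : forall k' n (f g : C (X n)), (k <= k')%N ->
  le_at k f g -> le_at k' f g.
Proof.
elim: k => [|k IHk] k' n f g; first by move=> _ fg x; exact: le_Lk.
by case: k' => [//|k'] kk' /= fg; exact: (IHk k' n.+1 (L n f) (L n g)).
Qed.

Definition within n k (f g : C (X n)) (a b : R) : Prop :=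
  le_at k (a *: g) f /\ le_at k f (b *: g).

Lemma withinP n k (f g : C (X n)) a b : within k f g a b <->
  forall x, a * Lk L n k g x <= Lk L n k f x <= b * Lk L n k g x.
Proof.
split=> [[af fb] x|fab].
  by have := af x; have := fb x; rewrite !LkZ !CZE => -> ->.
by split=> x; rewrite LkZ CZE; case/andP: (fab x).
Qed.

Lemma within_shift p n k (f g : C (X n)) a b :
  within k (Lk L n p f) (Lk L n p g) a b -> within (p + k) f g a b.
Proof. by move=> [af fb]; split; apply: le_at_shift; rewrite LkZ. Qed.

Lemma within_leq k k' n (f g : C (X n)) a b : (k <= k')%N ->
  within k f g a b -> within k' f g a b.
Proof. by move=> kk' [af fb]; split; exact: (le_at_leq kk'). Qed.

Local Notation E := (distortion Delta).
Local Notation theta := (contraction Delta).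

Let E_gt1 : 1 < E.
Proof. exact: distortion_gt1. Qed.

Let E_gt0 : 0 < E.
Proof. exact: lt_trans E_gt1. Qed.

Let theta01 : 0 < theta < 1.
Proof. exact: contraction01. Qed.

(** Each block of tau iterations is peeled off at the beginning, where
[diam_contraction] applies to functions of the cone at time n. *)
Lemma within_iter j : forall n (f g : C (X n)) a b, Lambda n g -> a <= b ->
  cone_le (Lambda n) (a *: g) f -> cone_le (Lambda n) f (b *: g) ->
  exists a' b', within (j * tau) f g a' b' /\ b' - a' <= theta ^+ j * (b - a).
Proof.
elim: j => [|j IHj] n f g a b Lg ab agf fbg.
  exists a, b; rewrite expr0 mul1r; split=> //; apply/withinP => x.
  have := cone_le_pointwise (@Lambda_Cplus n) agf x.
  have := cone_le_pointwise (@Lambda_Cplus n) fbg x.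
  by rewrite !CZE /= => -> ->.
have TL : Lk L n tau @` Lambda n `<=` Lambda (addk n tau).
  by move=> _ [h Lh <-]; exact: Lk_Lambda.
have [a1 [b1 [ba1 agf1 fbg1]]] := diam_contraction Delta_gt0 (@LkP tau n)
  (@Lambda_Cplus _) TL (@diam_tau n) Lg ab agf fbg.
have Lg1 := Lk_Lambda tau Lg.
have a1b1 : a1 <= b1.
  have [x gx] := CplusP (Lambda_Cplus Lg1).
  have := cone_le_pointwise (@Lambda_Cplus _) agf1 x.
  have := cone_le_pointwise (@Lambda_Cplus _) fbg1 x.
  by rewrite !CZE => h1 h2; rewrite -(ler_pM2r gx); lra.
have [a' [b' [fab ba']]] := IHj _ _ _ _ _ Lg1 a1b1 agf1 fbg1.
exists a', b'; split; first by rewrite mulSn; exact: within_shift.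
apply: (le_trans ba'); rewrite exprSr -mulrA ler_wpM2l// exprn_ge0//.
by case/andP: theta01 => /ltW.
Qed.

(** The first block only serves to place f between multiples of g in the cone
order; positivity bounds the lower multiple by M, hence the width by E M. The factor
E / theta absorbs this lost block and makes the case j = 0 trivial. *)
Lemma within_rate j n (f g : C (X n)) (M : R) : Lambda n f -> Lambda n g ->
  0 <= M -> (forall x, f x <= M * g x) ->
  exists a b, within (j * tau) f g a b /\ b - a <= M * (E / theta * theta ^+ j).
Proof.
have /andP[th0 th1] := theta01.
move=> Lf Lg M0 fMg; case: j => [|j].
  exists 0, M; split; [apply/withinP => x|]; last first.
    rewrite subr0 expr0 mulr1 ler_peMr// ler_pdivlMr// mul1r.
    by rewrite (le_trans (ltW th1))// ltW.
  rewrite mul0r fMg andbT.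
  by have [+ _] := Lambda_Cplus Lf; apply.
have TL : Lk L n tau @` Lambda n `<=` Lambda (addk n tau).
  by move=> _ [h Lh <-]; exact: Lk_Lambda.
have [a [b [a0 bEa agf fbg]]] := hilbert_diam_comparable (@Lambda_Cplus _) TL
  (@diam_tau n) (ex_intro2 _ _ f Lf erefl) (ex_intro2 _ _ g Lg erefl).
have Lg1 := Lk_Lambda tau Lg.
have [x gx] := CplusP (Lambda_Cplus Lg1).
have ax := cone_le_pointwise (@Lambda_Cplus _) agf x.
have bx := cone_le_pointwise (@Lambda_Cplus _) fbg x.
rewrite CZE in ax; rewrite CZE in bx.
have ab : a <= b by rewrite -(ler_pM2r gx); lra.
have aM : a <= M.
  have /withinP/(_ x)/andP[_] : within tau f g 0 M.
    apply: (@within_leq 0) => //; apply/withinP => y; rewrite /= mul0r fMg andbT.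
    by have [+ _] := Lambda_Cplus Lf; apply.
  by move=> h; rewrite -(ler_pM2r gx); lra.
have [a' [b' [fab ba']]] := within_iter j Lg1 ab agf fbg.
exists a', b'; split; first by rewrite mulSn; exact: within_shift.
apply: (le_trans ba'); rewrite exprS (mulrC theta) (mulrC E) !mulrA.
rewrite (_ : M / theta * E * theta ^+ j * theta = theta ^+ j * (M * E)); last first.
  by field; rewrite gt_eqF.
rewrite ler_wpM2l ?exprn_ge0 ?(ltW th0)//.
have : E * a <= E * M by rewrite ler_wpM2l// ltW.
lra.
Qed.

Let theta_cvg (M e : R) :
  0 < e -> exists j, M * (E / theta * theta ^+ j) <= e.
Proof.
move=> e0; have /andP[th0 th1] := theta01.
have : (fun j => M * (E / theta * theta ^+ j)) @ \oo --> (0 : R).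
  rewrite -[X in _ --> X](mulr0 M); apply: cvgMr.
  rewrite -[X in _ --> X](mulr0 (E / theta)); apply: cvgMr.
  by apply: cvg_expr; rewrite gtr0_norm.
move=> /cvgrPdist_le/(_ _ e0)[j _ /(_ j (leqnn j))/=].
by rewrite sub0r normrN => /(le_trans (ler_norm _)) ?; exists j.
Qed.

(** The symmetric form of an enclosure by multiples of L_n^k 1, convenient for
linear combinations. *)
Definition approx n k (f : C (X n)) (c e : R) : Prop :=
  forall x, `|Lk L n k f x - c * Lk L n k (oneC (X n)) x| <=
            e * Lk L n k (oneC (X n)) x.

Lemma approx_within n k (f : C (X n)) c e :
  approx k f c e <-> within k f (oneC (X n)) (c - e) (c + e).
Proof.
split=> [fce|/withinP fce]; [apply/withinP|] => x; have := fce x;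
  rewrite ler_norml !mulrBl !mulrDl.
  by move=> /andP[h1 h2]; apply/andP; split; lra.
by move=> /andP[h1 h2]; apply/andP; split; lra.
Qed.

Lemma approx_leq k k' n (f : C (X n)) c e : (k <= k')%N ->
  approx k f c e -> approx k' f c e.
Proof. by move=> kk' /approx_within/(within_leq kk')/approx_within. Qed.

Lemma within_approx n k (f : C (X n)) a b c : a <= c <= b ->
  within k f (oneC (X n)) a b -> approx k f c (b - a).
Proof.
move=> /andP[ac cb] /withinP fab; apply/approx_within/withinP => x.
have v0 := Lk_one_gt0 x; have /andP[h1 h2] := fab x.
apply/andP; split; [apply: le_trans h1|apply: (le_trans h2)];
  by rewrite ler_pM2r//; lra.
Qed.

Lemma approx_lin n k (f g : C (X n)) c d s e e' :
  approx k f c e -> approx k g d e' ->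
  approx k (s *: f + g) (s * c + d) (`|s| * e + e').
Proof.
move=> fce gde x; rewrite LkP !CE.
set v := Lk L n k (oneC _) x.
have -> : s * Lk L n k f x + Lk L n k g x - (s * c + d) * v =
          s * (Lk L n k f x - c * v) + (Lk L n k g x - d * v) by ring.
apply: (le_trans (ler_normD _ _)); rewrite mulrDl lerD ?gde//.
by rewrite normrM -mulrA ler_wpM2l// fce.
Qed.

(** This is what lets a uniformly small perturbation of f survive all iterations. *)
Lemma approx_norm n k (f : C (X n)) : approx k f 0 `|f|.
Proof.
apply: (@approx_leq 0) => // x /=.
by rewrite oneCE mul0r subr0 mulr1; exact: le_normC.
Qed.

Definition convergent n (f : C (X n)) : Prop :=
  forall e, 0 < e -> exists k c, approx k f c e.

(** Once L_n^p f is in the cone, so is L_n^p 1, and the rate applies to this pair: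
the comparison function need not be the constant 1 at time n + p. *)
Lemma Lambda_oo_convergent n (f : C (X n)) :
  Lambda_oo L Lambda n f -> convergent f.
Proof.
move=> [p _ [_ Lf]] e e0.
pose g := Lk L n p (oneC (X n)).
have Lg : Lambda (addk n p) g by apply/Lk_Lambda/Lambda_one.
have fg x : Lk L n p f x <= `|f| * g x.
  have := @approx_norm n p f x; rewrite mul0r subr0.
  by apply: le_trans; exact: ler_norm.
have [j jP] := theta_cvg `|f| e0.
have [a [b [fab ba]]] := within_rate j Lf Lg (normr_ge0 f) fg.
exists (p + j * tau)%N, a; have /withinP {}fab := within_shift fab.
apply/approx_within/withinP => x; have /andP[h1 h2] := fab x.
have v0 := Lk_one_gt0 x.
apply/andP; split; [apply: le_trans h1|apply: (le_trans h2)].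
  by rewrite ler_pM2r//; lra.
by rewrite ler_pM2r//; lra.
Qed.

Hypothesis HC3 : cond_C3 L Lambda.

Lemma all_convergent n (f : C (X n)) : convergent f.
Proof.
move=> e e0; have e30 : 0 < e / 3 by rewrite divr_gt0.
have : (ball f (e / 3) `&`
    [set u - v | u in Lambda_oo L Lambda n & v in Lambda_oo L Lambda n]) !=set0.
  apply: (HC3 (n := n)); last exact: ball_open.
  by exists f; exact: ballxx.
move=> [h [fh [u Lu [v Lv uvh]]]].
have [k1 [c uc]] := Lambda_oo_convergent Lu e30.
have [k2 [d vd]] := Lambda_oo_convergent Lv e30.
exists (maxn k1 k2), (c - d).
have {}uc := approx_leq (leq_maxl k1 k2) uc.
have {}vd := approx_leq (leq_maxr k1 k2) vd.
have := approx_lin 1 (approx_lin (-1) vd uc)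
  (@approx_norm n (maxn k1 k2) (f - h)).
rewrite !scale1r scaleN1r !mulN1r !mul1r addr0 addrC normrN normr1 !mul1r.
have -> : f - h + (- v + u) = f.
  by rewrite -uvh; apply/C_ext => x; rewrite !CE; ring.
have fh3 : `|f - h| < e / 3 by move: fh; rewrite -ball_normE.
rewrite (addrC (- d)) => H x; apply: (le_trans (H x)).
by rewrite ler_pM2r ?Lk_one_gt0//; lra.
Qed.

(** * The limiting functional *)

Definition lower_bounds n (f : C (X n)) : set R :=
  [set a | exists k, le_at k (a *: oneC (X n)) f].

(** The limit of the quotients of L_n^k f by L_n^k 1. As the lower bounds of these
quotients improve with k, it is their supremum, and no measure enters. *)
Definition limfun n (f : C (X n)) : R := sup (lower_bounds f).

Let lower_bounds_le n (f : C (X n)) k a b :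
  le_at k f (b *: oneC (X n)) -> lower_bounds f a -> a <= b.
Proof.
move=> fb [k' af]; have x : X (addk n (maxn k k')) := point.
have := le_at_leq (leq_maxl k k') fb x; have := le_at_leq (leq_maxr k k') af x.
rewrite !LkZ !CZE => h1 h2.
by rewrite -(ler_pM2r (Lk_one_gt0 x)); exact: le_trans h1 h2.
Qed.

Let lower_bounds_has_sup n (f : C (X n)) : has_sup (lower_bounds f).
Proof.
have [k [c /approx_within[cf fc]]] := all_convergent f ltr01.
split; first by exists (c - 1), k.
by exists (c + 1) => a; exact: lower_bounds_le fc.
Qed.

Lemma limfun_within n k (f : C (X n)) a b :
  within k f (oneC (X n)) a b -> a <= limfun f <= b.
Proof.
move=> [af fb]; apply/andP; split.
  by apply: ub_le_sup; [case: (lower_bounds_has_sup f)|exists k].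
apply: ge_sup; first by case: (lower_bounds_has_sup f).
by move=> d; exact: lower_bounds_le fb.
Qed.

Lemma limfun_ge0 n k (f : C (X n)) : le_at k 0 f -> 0 <= limfun f.
Proof.
move=> f0; apply: ub_le_sup; first by case: (lower_bounds_has_sup f).
by exists k; rewrite scale0r.
Qed.

Lemma limfun_approx n (f : C (X n)) e : 0 < e -> exists k0,
  forall k, (k0 <= k)%N -> approx k f (limfun f) e.
Proof.
move=> e0; have e20 : 0 < e / 2 by rewrite divr_gt0.
have [k0 [c /approx_within fc]] := all_convergent f e20.
exists k0 => k kk0; have := within_approx (limfun_within fc) fc.
rewrite (_ : c + e / 2 - (c - e / 2) = e); last by field.
exact: approx_leq.
Qed.

Lemma approx_limfun n k (f : C (X n)) c e :
  approx k f c e -> `|c - limfun f| <= e.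
Proof.
move=> /approx_within/limfun_within/andP[h1 h2].
by rewrite ler_norml; apply/andP; split; lra.
Qed.

Lemma limfun_eq n (f : C (X n)) c :
  (forall e, 0 < e -> exists k, approx k f c e) -> limfun f = c.
Proof.
move=> fc; apply/esym/eqP; rewrite -subr_eq0 -normr_le0.
apply/ler_addgt0Pr => e /fc[k /approx_limfun]; by rewrite add0r.
Qed.

Lemma limfun_scalar n : scalar (@limfun n).
Proof.
move=> s f g; apply: limfun_eq => e e0.
have s1 : 0 < `|s| + 1 by rewrite ltr_wpDl.
pose d := e / (`|s| + 1); have d0 : 0 < d by rewrite divr_gt0.
have [k1 fd] := limfun_approx f d0; have [k2 gd] := limfun_approx g d0.
exists (maxn k1 k2).
have := approx_lin s (fd _ (leq_maxl k1 k2)) (gd _ (leq_maxr k1 k2)).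
by rewrite (_ : `|s| * d + d = e)// /d; field; rewrite gt_eqF.
Qed.

Lemma limfunZ n s (f : C (X n)) : limfun (s *: f) = s * limfun f.
Proof.
have lim0 : limfun (0 : C (X n)) = 0.
  by have := @limfun_scalar n 1 0 0; rewrite scale1r addr0; lra.
by have := limfun_scalar s f 0; rewrite lim0 !addr0.
Qed.

Lemma limfun_one n : limfun (oneC (X n)) = 1.
Proof.
apply: limfun_eq => e e0; exists 0%N => x.
by rewrite mul1r subrr normr0 mulr_ge0 ?ltW ?Lk_one_gt0.
Qed.

Lemma limfun_pos n (f : C (X n)) : (forall x, 0 <= f x) -> 0 <= limfun f.
Proof. by move=> f0; apply: (@limfun_ge0 n 0). Qed.

(** The quotient defining lambda_n is that of L_n^k (L_n 1) by L_(n+1)^k 1. *)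
Definition lam n : R := limfun (L n (oneC (X n))).

Lemma lam_bounds n : kappa^-1 <= lam n <= kappa.
Proof.
apply: (@limfun_within n.+1 0); apply/withinP => x /=.
by rewrite oneCE !mulr1; exact: L_one.
Qed.

Lemma lam_gt0 n : 0 < lam n.
Proof. by case/andP: (lam_bounds n) => + _; apply: lt_le_trans; rewrite invr_gt0. Qed.

(** An enclosure of f by multiples of 1 at time n is, after one application of
L_n, an enclosure of L_n f by the same multiples of L_n 1 at time n + 1; the
functional at time n + 1 then reads off the equation. *)
Lemma limfun_L n (f : C (X n)) : limfun (L n f) = lam n * limfun f.
Proof.
have limB := @limfun_scalar n.+1.
apply/eqP; rewrite -subr_eq0 -normr_le0.
apply/ler_addgt0Pr => e e0; rewrite add0r.
have d0 : 0 < e / lam n by rewrite divr_gt0// lam_gt0.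
have [k fk] := limfun_approx f d0.
have := fk k.+1 (leqnSn k); move/approx_within => -[fl fr].
set c := limfun f in fl fr *; set d := e / lam n in d0 fl fr *.
have le_lim s : le_at k (s *: L n (oneC _)) (L n f) -> s * lam n <= limfun (L n f).
  move=> sf; rewrite -subr_ge0.
  have -> : limfun (L n f) - s * lam n = limfun (- s *: L n (oneC _) + L n f).
    by rewrite limB mulNr addrC.
  apply: (@limfun_ge0 _ k) => x; have := sf x.
  by rewrite LkP !LkZ Lk0 !CE mulNr addrC subr_ge0.
have ge_lim s : le_at k (L n f) (s *: L n (oneC _)) -> limfun (L n f) <= s * lam n.
  move=> sf; rewrite -subr_ge0.
  have -> : s * lam n - limfun (L n f) = limfun (-1 *: L n f + s *: L n (oneC _)).
    by rewrite limB limfunZ mulN1r addrC.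
  apply: (@limfun_ge0 _ k) => x; have := sf x.
  by rewrite LkP !LkZ Lk0 !CE mulN1r addrC subr_ge0.
have := le_lim (c - d); have := ge_lim (c + d).
rewrite -!linearZ => /(_ fr) h1 /(_ fl) h2.
have dE : d * lam n = e by rewrite /d divfK ?gt_eqF ?lam_gt0.
rewrite ler_norml; apply/andP; split; lra.
Qed.

(** * The exponential rate *)

Lemma approx_weaken n k (f : C (X n)) c e e' : e <= e' ->
  approx k f c e -> approx k f c e'.
Proof.
by move=> ee' fce x; apply: (le_trans (fce x)); rewrite ler_wpM2r// ltW ?Lk_one_gt0.
Qed.

(* For tau = 0 the cones themselves have diameter at most Delta, and contracting
   once per iteration is sound with blocks of length 1. *)
Local Notation tau1 := (maxn tau 1).
Local Notation gamma := (1 - (1 - theta) / tau1%:R).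

Let tau1_gt0 : (0 < tau1)%N.
Proof. by rewrite leq_max orbT. Qed.

Let gamma01 : theta <= gamma < 1.
Proof.
have /andP[th0 th1] := theta01.
have t1 : 1 <= tau1%:R :> R by rewrite ler1n.
have t0 : 0 < tau1%:R :> R by rewrite ltr0n.
rewrite ltrBlDr ltrDl divr_gt0 ?subr_gt0// andbT.
have : (1 - theta) / tau1%:R <= 1 - theta.
  by rewrite ler_pdivrMr// ler_peMr// subr_ge0 ltW.
by lra.
Qed.

Let gamma_gt0 : 0 < gamma.
Proof.
by have /andP[th0 _] := theta01; have /andP[+ _] := gamma01; apply: lt_le_trans.
Qed.

(** Bernoulli's inequality gives theta <= gamma ^ tau1, so gamma is a rate per
single step; the factor 1 / theta accounts for the incomplete last block. *)
Let theta_gamma k : theta ^+ (k %/ tau1) <= theta^-1 * gamma ^+ k.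
Proof.
have /andP[th0 th1] := theta01; have /andP[_ g1] := gamma01.
have th_le : theta <= gamma ^+ tau1.
  apply: le_trans (bernoulli_ineq _ _); last first.
    apply/andP; split; last by rewrite -subr_ge0 ltW.
    by rewrite divr_ge0// subr_ge0 ltW.
  by rewrite mulrC divfK ?subKr// pnatr_eq0 -lt0n.
rewrite -ler_pdivrMl ?invr_gt0// invrK -exprS.
apply: (@le_trans _ _ ((gamma ^+ tau1) ^+ (k %/ tau1).+1)).
  by apply: lerXn2r; rewrite // nnegrE ltW// exprn_gt0.
rewrite -exprM; apply: ler_wiXn2l; [exact: ltW|exact: ltW|].
by rewrite mulnC ltnW// ltn_ceil.
Qed.

Local Notation K := (E / theta / theta).

Lemma limfun_rate k n (f : C (X n)) M : Lambda n f -> 0 <= M ->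
  (forall x, f x <= M) -> approx k f (limfun f) (M * (K * gamma ^+ k)).
Proof.
have /andP[th0 th1] := theta01.
move=> Lf M0 fM.
have fM1 x : f x <= M * oneC (X n) x by rewrite oneCE mulr1.
have [a [b [fab ba]]] := within_rate (k %/ tau1) Lf (Lambda_one n) M0 fM1.
have jk : (k %/ tau1 * tau <= k)%N.
  by apply: leq_trans (leq_trunc_div k tau1); rewrite leq_mul2l leq_maxl orbT.
apply: (approx_leq jk); apply: approx_weaken (within_approx (limfun_within fab) fab).
apply: (le_trans ba); rewrite ler_wpM2l// -[E / theta / theta * _]mulrA.
by rewrite ler_wpM2l ?theta_gamma// divr_ge0 ?ltW.
Qed.

Lemma pairing_Lk_one_gt0 n k (sigma : M (X (addk n k))) :
  0 < pairing (Lk L n k (oneC (X n))) sigma.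
Proof.
have c0 : 0 < kappa^-1 ^+ k by rewrite exprn_gt0// invr_gt0.
apply: (@lt_le_trans _ _ (pairing (kappa^-1 ^+ k *: oneC _) sigma)).
  rewrite pairingZ pairing_one mulr_gt0// fine_gt0// lt0e M_neq0 measure_ge0/=.
  by rewrite -ge0_fin_numE// fin_num_measure.
by apply: le_pairing => x; rewrite CZE oneCE mulr1; exact: Lk_one_ge.
Qed.

Lemma approx_ratio n k (f : C (X n)) c e (sigma : M (X (addk n k))) :
  approx k f c e ->
  `|c - pairing (Lk L n k f) sigma / pairing (Lk L n k (oneC (X n))) sigma| <= e.
Proof.
move=> /approx_within[cf fc]; have v0 := pairing_Lk_one_gt0 sigma.
have := le_pairing sigma cf; have := le_pairing sigma fc.
rewrite !LkZ !pairingZ -ler_pdivrMr// => h1; rewrite -ler_pdivlMr// => h2.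
by rewrite ler_norml; apply/andP; split; lra.
Qed.

Lemma ratio_cvg n (f : C (X n)) (sigma : forall l, M (X l)) :
  pairing (Lk L n k f) (sigma (addk n k)) /
    pairing (Lk L n k (oneC (X n))) (sigma (addk n k)) @[k --> \oo] --> limfun f.
Proof.
apply/cvgrPdist_le => e e0; have [k0 fk0] := limfun_approx f e0.
by exists k0 => // k /= kk0; exact/approx_ratio/fk0.
Qed.

Let ln_lipschitz x y : kappa^-1 <= x -> kappa^-1 <= y ->
  ln x - ln y <= kappa * `|x - y|.
Proof.
move=> kx ky; have k0 : 0 < kappa^-1 by rewrite invr_gt0.
have x0 := lt_le_trans k0 kx; have y0 := lt_le_trans k0 ky.
rewrite -ln_div ?posrE//.
have -> : x / y = 1 + (x - y) / y by field; rewrite gt_eqF.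
apply: (le_trans (le_ln1Dx _)).
  by rewrite mulrBl divff ?gt_eqF// ltrBrDr addNr divr_gt0.
apply: (@le_trans _ _ (`|x - y| / y)); first by rewrite ler_pM2r ?invr_gt0// ler_norm.
rewrite mulrC ler_wpM2r// -[kappa]invrK lef_pV2// posrE.
Qed.

(** The exponent is k and not k + 1: as a quotient at time n + 1, the expression
has undergone one iteration less. *)
Lemma ln_ratio_rate n k (sigma : M (X (addk n k.+1))) :
  `| ln (lam n) - ln (pairing (Lk L n k.+1 (oneC (X n))) sigma /
       pairing (Lk L n.+1 k (oneC (X n.+1))) sigma) |
  <= kappa * (kappa * (K * gamma ^+ k)).
Proof.
set r := _ / _.
have L1 : Lambda n.+1 (L n (oneC (X n))) by apply/L_Lambda/Lambda_one.
have L1k x : L n (oneC (X n)) x <= kappa by case/andP: (L_one x).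
have := @approx_ratio n.+1 k _ _ _ sigma
  (@limfun_rate k n.+1 _ _ L1 (ltW kappa_gt0) L1k).
rewrite -[limfun _]/(lam n) -/r => lam_r.
have kr : kappa^-1 <= r.
  rewrite ler_pdivlMr ?(pairing_Lk_one_gt0 (n := n.+1))// -pairingZ.
  apply: le_pairing => x; rewrite -LkZ; apply: le_Lk => y.
  by rewrite CZE oneCE mulr1; case/andP: (L_one y).
have kl : kappa^-1 <= lam n by case/andP: (lam_bounds n).
have h1 := ln_lipschitz kl kr; have h2 := ln_lipschitz kr kl.
have : kappa * `|lam n - r| <= kappa * (kappa * (K * gamma ^+ k)).
  by rewrite ler_wpM2l// ltW.
rewrite distrC in h2.
by rewrite ler_norml => ?; apply/andP; split; lra.
Qed.

Lemma exponential_rate : exists C1 rho : R, [/\ 0 < C1, 0 < rho < 1 &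
  forall (n k : nat) (sigma : M (X (addk n k.+1))) (f : C (X n)), Lambda n f ->
    `| ln (lam n) - ln (pairing (Lk L n k.+1 (oneC (X n))) sigma /
         pairing (Lk L n.+1 k (oneC (X n.+1))) sigma) | <= C1 * rho ^+ k.+1 /\
    `| limfun f - pairing (Lk L n k.+1 f) sigma /
         pairing (Lk L n k.+1 (oneC (X n))) sigma | <= C1 * `|f| * rho ^+ k.+1].
Proof.
have /andP[th0 th1] := theta01; have /andP[_ g1] := gamma01; have g0 := gamma_gt0.
have K0 : 0 < K by rewrite !divr_gt0.
exists (kappa * (kappa * K) / gamma), gamma; split.
- by rewrite divr_gt0// mulr_gt0// mulr_gt0.
- by rewrite g0.
- move=> n k sigma f Lf; split.
    apply: (le_trans (ln_ratio_rate sigma)).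
    rewrite exprS [X in _ <= X]mulrA divfK ?gt_eqF//.
    by rewrite -!mulrA.
  have := approx_ratio sigma (@limfun_rate k.+1 n _ _ Lf (normr_ge0 f) (C_le_norm f)).
  move/le_trans; apply; rewrite [leLHS]mulrA [X in X * _ <= _]mulrC.
  rewrite ler_pM2r ?exprn_gt0// ler_wpM2r//.
  rewrite ler_pdivlMr//; apply: (@le_trans _ _ K); first by rewrite ler_piMr// ltW.
  have : K <= kappa * K by rewrite ler_peMl// ltW.
  move/le_trans; apply; rewrite ler_peMl// mulr_ge0// ltW//.
Qed.

Lemma limfun_measure n :
  exists m : probability (Borel (X n)) R, forall f, pairing f m = limfun f.
Proof.
by apply: riesz_representation;
  [exact: limfun_scalar|exact: limfun_pos|exact: limfun_one].
Qed.

(** Proportionality passes to the iterates, so the quotient of the integrals of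
L_n^k f and L_n^k 1 is the integral of f for every k. *)
Lemma eigensequence_limfun (m : forall n, probability (Borel (X n)) R) :
  dual_eigensequence L m -> forall n f, pairing f (m n) = limfun f.
Proof.
move=> m_eigen n f.
have iter k : forall n, exists c, forall f,
    pairing (Lk L n k f) (m (addk n k)) = c * pairing f (m n).
  elim: k => [|k IHk] i; first by exists 1 => g; rewrite mul1r.
  have [c cP] := IHk i.+1; have [d dP] := m_eigen i.
  exists (c * d) => g /=.
  by rewrite cP -[pairing (L i g) _]/(dual_op (L i) _ g) dP mulrA.
apply/eqP; rewrite -subr_eq0 -normr_le0 distrC.
apply/ler_addgt0Pr => e e0; have [k /(_ k (leqnn k)) fk] := limfun_approx f e0.
have mk0 : (m (addk n k) setT != 0)%E by rewrite probability_setT onee_neq0.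
have := approx_ratio (MkM mk0) fk; have := pairing_Lk_one_gt0 (MkM mk0).
have [c cP] := iter k n.
have -> : pairing (Lk L n k f) (MkM mk0) = c * pairing f (m n) by exact: cP.
have -> : pairing (Lk L n k (oneC (X n))) (MkM mk0) = c.
  have m1 : pairing (oneC (X n)) (m n) = 1.
    rewrite /pairing Rintegral_cst// mul1r -[RHS]/(fine 1%E).
    by congr fine; exact: (probability_setT (m n)).
  by have := cP (oneC (X n)); rewrite m1 mulr1; apply.
by move=> c0; rewrite mulrAC divff ?gt_eqF// mul1r add0r.
Qed.

End iterates.

(** * The main theorem *)

Theorem theorem2p6 (R : realType) (X : nat -> compactMetricType R)
    (L : forall n, {linear C (X n) -> C (X n.+1)})
    (Lambda : forall n, set (C (X n)))
    (kappa Delta : R) (tau : nat)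
    (L_dual : forall n, dual_maps_measures (L n))
    (HC1 : cond_C1 Lambda)
    (HC2 : cond_C2 L Lambda kappa Delta tau)
    (HC3 : cond_C3 L Lambda) :
  exists (lambda : nat -> R) (m : forall n, probability (Borel (X n)) R),
  [/\ (* A *)
      forall (n : nat) (sigma : forall l, M (X l)),
        pairing (Lk L n k.+1 (oneC (X n))) (sigma (addk n k.+1)) /
          pairing (Lk L n.+1 k (oneC (X n.+1))) (sigma (addk n k.+1))
          @[k --> \oo] --> lambda n /\
        weak_star_cvg
          (fun k f => dual_op (Lk L n k) (sigma (addk n k)) f /
                      dual_op (Lk L n k) (sigma (addk n k)) (oneC (X n)))
          (m n),
      (* B *)
      forall n, 0 < lambda n /\
        forall f, dual_op (L n) (m n.+1) f = lambda n * pairing f (m n),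
      (* C *)
      dual_eigensequence L m /\
      forall m' : (forall n, probability (Borel (X n)) R),
        dual_eigensequence L m' ->
        forall n (A : set (Borel (X n))), measurable A -> m' n A = m n A &
      (* D *)
      exists C1 gamma : R, [/\ 0 < C1, 0 < gamma < 1 &
        forall (n k : nat) (sigma : M (X (addk n k.+1))) (f : C (X n)),
          (tau <= k.+1)%N -> Lambda n f ->
          `| ln (lambda n) -
             ln (pairing (Lk L n k.+1 (oneC (X n))) sigma /
                 pairing (Lk L n.+1 k (oneC (X n.+1))) sigma) |
            <= C1 * gamma ^+ k.+1 /\
          `| pairing f (m n) -
             dual_op (Lk L n k.+1) sigma f /
               dual_op (Lk L n k.+1) sigma (oneC (X n)) |
            <= C1 * `|f| * gamma ^+ k.+1]].
Proof.
pose m n := projT1 (cid (limfun_measure L_dual HC1 HC2 HC3 n)).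
have mE n f : pairing f (m n) = limfun L f.
  exact: (projT2 (cid (limfun_measure L_dual HC1 HC2 HC3 n))).
have eigen n f : dual_op (L n) (m n.+1) f = lam L n * pairing f (m n).
  rewrite [LHS](mE n.+1) mE; exact: (limfun_L L_dual HC1 HC2 HC3).
exists (lam L), m; split.
- move=> n sigma; split=> [|f]; last first.
    rewrite mE; exact: (ratio_cvg L_dual HC1 HC2 HC3).
  apply/cvgrPdist_le => e e0.
  have [k0 fk0] := limfun_approx L_dual HC1 HC2 HC3 (L n (oneC (X n))) e0.
  exists k0 => // k /= kk0.
  exact: (@approx_ratio _ _ _ _ _ _ _ L_dual HC2 n.+1 k _ _ _ (sigma _)
    (fk0 k kk0)).
- by move=> n; split; [exact: (lam_gt0 L_dual HC1 HC2 HC3)|exact: eigen].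
- split; first by move=> n; exists (lam L n); exact: eigen.
  move=> m' m'_eigen n A mA; apply: pairing_inj => // f.
  by rewrite [RHS]mE; exact: (eigensequence_limfun L_dual HC1 HC2 HC3 m'_eigen).
- have [C1 [rho [C0 rho01 rateP]]] := exponential_rate L_dual HC1 HC2 HC3.
  exists C1, rho; split=> // n k sigma f _ Lf.
  by rewrite mE; exact: rateP.
Qed.
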